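(* Let $\Sigma$ be a $\sigma$-algebra on a non-empty set $\mathcal{A}$. Let $\nu,\mu$ be (finite, complex) measures on $(\mathcal{A},\Sigma)$, with $\nu$ non-negative. There exist unique (complex) measures $\mu_a,\mu_s$ on $(\mathcal{A},\Sigma)$ such that (i) $\mu=\mu_a+\mu_s$; (ii) $\mu_a$ is $\nu$-absolutely continuous and $\mu_s$ is $\nu$-singular.
   Context: All measures are finite; ''measure'' means a complex (countably additive) measure on $(\mathcal{A},\Sigma)$. A measure $\mu$ is non-negative if $\mu(A)\ge0$ for all $A\in\Sigma$. For $\nu$ non-negative: $\mu$ is $\nu$-absolutely continuous if $\nu(A)=0$ implies $\mu(A)=0$ for $A\in\Sigma$; $\mu$ is $\nu$-singular if there is $E\in\Sigma$ such that $\nu(A)=\nu(A\cap E)$ and $\mu(A)=\mu(A\cap E^c)$ for all $A\in\Sigma$. *)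

(* Defs.v *)
From HB Require Import structures.
From mathcomp Require Import all_boot all_order all_algebra.
From mathcomp Require Import complex.
From mathcomp Require Import all_classical all_reals all_analysis.

Set Implicit Arguments.
Unset Strict Implicit.
Unset Printing Implicit Defensive.

Import Order.TTheory GRing.Theory Num.Theory.
Import numFieldNormedType.Exports.

Local Open Scope classical_set_scope.
Local Open Scope ring_scope.
Local Open Scope ereal_scope.

(* A finite complex measure is a charge with values in [\bar R[i]]: charges
   take finite values, so only the part [R[i]] of [\bar R[i]] is reached, and
   around finite points the topology of [\bar R[i]] is that of [R[i]]. *)
Notation complex_measure T R := (charge T R[i]).

Section complex_measures.
Context d (T : measurableType d) (R : realType).
Implicit Types nu mu : set T -> \bar R[i].

(* In the partial order on [R[i]], [0 <= z] means that [z] is real and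
   nonnegative. *)
Definition nonnegative_measure nu := forall A, measurable A -> 0 <= nu A.

Definition absolutely_continuous_wrt nu mu :=
  forall A, measurable A -> nu A = 0 -> mu A = 0.

Definition singular_wrt nu mu := exists E, measurable E /\
  forall A, measurable A -> nu A = nu (A `&` E) /\ mu A = mu (A `&` ~` E).

(* Set functions are total on [set T]; a measure is only its values on the
   measurable sets, so two measures are identified when these agree. *)
Definition eq_on_measurable nu mu := forall A, measurable A -> nu A = mu A.

End complex_measures.

(* Main.v *)
(* There is a nu-null set N on whose complement mu kills every nu-null set: for
   each e > 0 finitely many steps of exhaustion give a nu-null N_e such that
   |mu A| < e for all nu-null A disjoint from N_e, and N is the union of the
   N_{1/k}. Then mu_a and mu_s are the restrictions of mu to the complement of
   N and to N. Working with mu itself, through the convergence of its series on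
   disjoint sets, avoids the total variation, the Hahn decomposition and real
   and imaginary parts. Any other decomposition has these same parts: its
   absolutely continuous part vanishes on N, and its singular part, carried by
   a null set, vanishes off N. *)
Require Import Defs.
From mathcomp Require Import all_boot all_order all_algebra.
From mathcomp Require Import complex.
From mathcomp Require Import all_classical all_reals all_analysis.

Local Open Scope classical_set_scope.
Local Open Scope ring_scope.
Local Open Scope ereal_scope.

Set Implicit Arguments.
Unset Strict Implicit.
Unset Printing Implicit Defensive.

Import Order.TTheory GRing.Theory Num.Theory.
Import numFieldNormedType.Exports.

Section null_sets.
Context (d : measure_display) (T : measurableType d) (K : numFieldType).
Implicit Types (nu mu : charge T K) (A B N : set T) (F : nat -> set T).

(** Sigma-additivity is moved from extended values to the normed space [K^o], where limits are
    unique and terms of convergent series tend to 0. *)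
Lemma fine_charge_series_cvg mu F :
  (forall i, measurable (F i)) -> trivIset setT F ->
  series (fun i => fine (mu (F i)) : K^o) @ \oo --> (fine (mu (\bigcup_i F i)) : K^o).
Proof.
move=> mF tF; have mU : measurable (\bigcup_i F i) by exact: bigcupT_measurable.
have := charge_semi_sigma_additive (s := mu) F mF tF mU.
rewrite -{1}(fineK (fin_num_measure mu _ mU)) => /fine_cvg.
apply: cvg_trans; apply: near_eq_cvg; near=> n.
by rewrite /= /series /= sum_fine // => i _; exact: fin_num_measure.
Unshelve. all: by end_near. Qed.

Lemma charge_bigcup_eq0 nu F :
  (forall i, measurable (F i)) -> trivIset setT F ->
  (forall i, nu (F i) = 0) -> nu (\bigcup_i F i) = 0.
Proof.
move=> mF tF F0; have mU : measurable (\bigcup_i F i) by exact: bigcupT_measurable.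
rewrite -[LHS](fineK (fin_num_measure nu _ mU)); congr _%:E.
have := fine_charge_series_cvg (mu := nu) mF tF.
rewrite (_ : series _ = fun=> 0%R); last first.
  by apply/funext => n; rewrite /series /= big1 // => i _; rewrite F0.
move=> h; exact: (cvg_unique (@norm_hausdorff _ _) h (cvg_cst _)).
Qed.

Lemma charge_trivIset_lt mu F (e : K) :
  (0 < e)%R -> (forall i, measurable (F i)) -> trivIset setT F ->
  exists i, (`|fine (mu (F i))| < e)%R.
Proof.
move=> e0 mF tF.
have /cvgP/cvg_series_cvg_0/cvgr_dist_lt/(_ _ e0)[n _ /(_ n)] :=
  fine_charge_series_cvg (mu := mu) mF tF.
by rewrite /= sub0r normrN => /(_ (leqnn n)); exists n.
Qed.

Section exhaustion.
Variables nu mu : charge T K.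
Hypothesis nu_ge0 : forall A, measurable A -> 0 <= nu A.

(** Two nonnegative values, those at [A] and at the rest of [N], add up to 0. *)
Lemma charge_null_subset N A : measurable N -> measurable A ->
  A `<=` N -> nu N = 0 -> nu A = 0.
Proof.
move=> mN mA AN; rewrite (chargeDI nu mN mA) setIC (setIidl AN) => /eqP.
rewrite padde_eq0 ?nu_ge0//; last exact: measurableD.
by case/andP => _ /eqP.
Qed.

Lemma charge_null_bigcup F : (forall i, measurable (F i)) ->
  (forall i, nu (F i) = 0) -> nu (\bigcup_i F i) = 0.
Proof.
move=> mF F0; rewrite seqDU_bigcup_eq; apply: charge_bigcup_eq0 => [i||i].
- exact: seqDU_measurable.
- exact: trivIset_seqDU.
- by apply: (@charge_null_subset (F i)) => //;
    [exact: seqDU_measurable | exact: subset_seqDU].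
Qed.

Lemma charge_nullU A B : measurable A -> measurable B ->
  nu A = 0 -> nu B = 0 -> nu (A `|` B) = 0.
Proof.
move=> mA mB A0 B0; rewrite -bigcup2E; apply: charge_null_bigcup.
  by move=> [|[|i]] //=.
by move=> [|[|i]] //=; exact: charge0.
Qed.

(* Otherwise one could pick successively infinitely many disjoint null sets
   [A] with [e <= |mu A|], although the terms of the series given by
   sigma-additivity tend to 0. *)
Lemma exists_null_lt (e : K) : (0 < e)%R ->
  exists N, [/\ measurable N, nu N = 0 & forall A, measurable A -> nu A = 0 ->
    A `&` N = set0 -> (`|fine (mu A)| < e)%R].
Proof.
move=> e0; apply: contrapT => noN.
(* The assumptions on [N] stand under the existential so that [choice] yields a total [f]; for the
   other [N], the witness [set0] is arbitrary. *)
have step N : exists A, measurable N -> nu N = 0 ->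
    [/\ measurable A, nu A = 0, A `&` N = set0 & (e <= `|fine (mu A)|)%R].
  apply: contrapT => noA; apply: noN.
  have mN : measurable N by apply: contrapT => mN; apply: noA; exists set0.
  have N0 : nu N = 0 by apply: contrapT => N0; apply: noA; exists set0.
  exists N; split=> // A mA A0 AN.
  (* The order of [K] may be partial, but both sides are real and hence comparable. *)
  rewrite (real_ltNge (normr_real _) (gtr0_real e0)).
  by apply/negP => eA; apply: noA; exists A.
have [f fP] := choice step.
(* [G n] is the union of the first [n] chosen sets, and [f (G n)] is the next one. *)
pose G n := iter n (fun N => N `|` f N) set0.
have GP n : measurable (G n) /\ nu (G n) = 0.
  elim: n => [|n [mG G0]]; first by rewrite /G /=; split; [|exact: charge0].
  have [mf f0 _ _] := fP _ mG G0; split; first exact: measurableU.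
  exact: charge_nullU.
have fGP n := fP _ (GP n).1 (GP n).2.
have mF n : measurable (f (G n)) by case: (fGP n).
have fG i j : (i < j)%N -> f (G i) `<=` G j.
  elim: j => // j IH; rewrite ltnS leq_eqVlt => /predU1P[->|ij] x fx.
    by right.
  by left; exact: IH.
have tF : trivIset setT (f \o G).
  apply/trivIsetP => i j _ _ ij /=.
  wlog lt_ij : i j ij / (i < j)%N.
    move=> h; have [|ji] := ltnP i j; first exact: h.
    by rewrite setIC; apply: h; [rewrite eq_sym | rewrite ltn_neqAle eq_sym ij].
  rewrite -subset0 => x [fi fj]; have [_ _ <- _] := fGP j.
  by split=> //; exact: (fG _ _ lt_ij).
have [n] := charge_trivIset_lt mu e0 mF tF.
by have [_ _ _ en] := fGP n; rewrite /= (le_gtF en).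
Qed.

Lemma lebesgue_decomposition_parts (a s : charge T K) N E :
  measurable N -> nu N = 0 ->
  (forall A, measurable A -> nu A = 0 -> A `&` N = set0 -> mu A = 0) ->
  (forall A, measurable A -> mu A = a A + s A) ->
  (forall A, measurable A -> nu A = 0 -> a A = 0) ->
  measurable E -> nu (~` E) = 0 ->
  (forall A, measurable A -> s A = s (A `&` ~` E)) ->
  forall A, measurable A -> a A = mu (A `&` ~` N) /\ s A = mu (A `&` N).
Proof.
move=> mN N0 maxN mu_as a_nu mE E0 sE A mA.
have mAN : measurable (A `&` N) by exact: measurableI.
have mANC : measurable (A `&` ~` N) by apply: measurableI => //; exact: measurableC.
have mEC : measurable (~` E) by exact: measurableC.
have aN : a (A `&` N) = 0 by apply: a_nu => //; exact: (charge_null_subset mN mAN (@subIsetr _ _ _) N0).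
have sN : s (A `&` ~` N) = 0.
  (* The set [B] lies in the null set outside [E], so [a B = 0] and [s B = mu B]; this is 0 because
     [B] also avoids [N]. *)
  rewrite sE //; set B := _ `&` _ `&` _.
  have mB : measurable B by exact: measurableI.
  have B0 : nu B = 0 by exact: (charge_null_subset mEC mB (@subIsetr _ _ _) E0).
  have := mu_as _ mB; rewrite (a_nu _ mB B0) add0e => <-; apply: maxN => //.
  by rewrite -subset0 => x [[[_ /=]]].
split.
  by rewrite (chargeDI a mA mN) aN adde0 setDE mu_as // sN adde0.
by rewrite (chargeDI s mA mN) setDE sN add0e mu_as // aN add0e.
Qed.

End exhaustion.
End null_sets.

Section complex_null_sets.
Context (d : measure_display) (T : measurableType d) (R : realType).
Variables nu mu : complex_measure T R.
Hypothesis nu_ge0 : nonnegative_measure nu.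

Lemma exists_null_maximal : exists N, [/\ measurable N, nu N = 0 &
  forall A, measurable A -> nu A = 0 -> A `&` N = set0 -> mu A = 0].
Proof.
have k0 (k : nat) : (0 < (k.+1%:R^-1)%:C%C :> R[i])%R by rewrite ltcR invr_gt0.
have [N NP] := choice (fun k => exists_null_lt mu nu_ge0 (k0 k)).
have mN k : measurable (N k) by case: (NP k).
exists (\bigcup_k N k); split.
- exact: bigcupT_measurable.
- by apply: charge_null_bigcup => // k; case: (NP k).
move=> A mA A0 AN; rewrite -[mu A]fineK ?fin_num_measure //; congr _%:E.
apply/eqP; rewrite -normr_eq0; apply: contraT => muA0.
(* In [R[i]], [0 < z] is a condition on the imaginary part together with a strict inequality of real
   parts; the Archimedean property of [R] applies to the latter. *)
have /andP[Im0 Re0] : (0 < `|fine (mu A)|)%R by rewrite normr_gt0 -normr_eq0.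
have [k] := ltr_add_invr Re0; rewrite add0r => kA.
have [_ _ /(_ A mA A0)] := NP k.
have ANk : A `&` N k = set0.
  by rewrite -subset0 => x [Ax Nx]; rewrite -AN; split=> //; exists k.
by move=> /(_ ANk) /andP[_] /(lt_trans kA) /=; rewrite ltxx.
Qed.

End complex_null_sets.

Theorem theorem4p2 (d : measure_display) (T : measurableType d) (R : realType)
  (nu mu : complex_measure T R) (nu_ge0 : nonnegative_measure nu) :
  exists mu_a mu_s : complex_measure T R,
    [/\ eq_on_measurable mu (mu_a \+ mu_s),
        absolutely_continuous_wrt nu mu_a /\ singular_wrt nu mu_s
      & forall mu_a' mu_s' : complex_measure T R,
          eq_on_measurable mu (mu_a' \+ mu_s') ->
          absolutely_continuous_wrt nu mu_a' -> singular_wrt nu mu_s' ->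
          eq_on_measurable mu_a' mu_a /\ eq_on_measurable mu_s' mu_s].
Proof.
have [N [mN N0 maxN]] := exists_null_maximal mu nu_ge0.
have mNC : measurable (~` N) by exact: measurableC.
exists (crestr mu mNC), (crestr mu mN); split.
- by move=> A mA; rewrite (chargeDI mu mA mN) setDE.
- split=> [A mA A0|].
    have mANC : measurable (A `&` ~` N) by exact: measurableI.
    apply: maxN => //; last by rewrite -setIA setICl setI0.
    by apply: (@charge_null_subset _ _ _ _ nu_ge0 A) => //; exact: subIsetl.
  (* As [N] is null, [nu] is carried by its complement. *)
  exists (~` N); split=> // A mA; split; last first.
    by rewrite setCK; congr (mu _); rewrite -setIA setIid.
  have mAN : measurable (A `&` N) by exact: measurableI.
  rewrite (chargeDI nu mA mN) setDE.
  by rewrite (charge_null_subset nu_ge0 mN mAN) ?adde0.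
move=> a s mu_as a_nu [E [mE sE]].
have mEC : measurable (~` E) by exact: measurableC.
(* Singularity is applied to the complement of [E] itself, which meets [E] in the empty set. *)
have E0 : nu (~` E) = 0.
  by have [-> _] := sE _ mEC; rewrite setICl charge0.
have parts := lebesgue_decomposition_parts nu_ge0 mN N0 maxN mu_as a_nu mE E0
  (fun A mA => (sE A mA).2).
(* The values in [parts] are by definition those of the two restrictions [crestr]. *)
by split=> A mA; have [] := parts A mA.
Qed.
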